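(* The set of axioms $\mathcal{S}=\{$(R1), (R2), (R3), (R4), (R5), (R6), (R8), (R8$'$), (R10)$\}$ is independent. That is, for each axiom $\varphi$ in $\mathcal{S}$, $\varphi$ is not derivable from the other axioms of $\mathcal{S}$: there is an algebra $(A,+,-,;,{}^{\smile},1')$ in which $\varphi$ fails and in which all the other axioms of $\mathcal{S}$ are valid.
   Context: All algebras have the form $\mathfrak{A}=(A,+,-,;,{}^{\smile},1')$, where $A$ is a non-empty set, $+$ and $;$ are binary operations on $A$, $-$ and ${}^{\smile}$ are unary operations on $A$, and $1'$ is a distinguished element of $A$. Unary operations bind more tightly than binary ones, and $;$ binds more tightly than $+$. An axiom is valid in $\mathfrak{A}$ if it holds for all elements $r,s,t\in A$; otherwise it fails in $\mathfrak{A}$. The axioms of $\mathcal{S}$ are: (R1) $r+s=s+r$; (R2) $r+(s+t)=(r+s)+t$; (R3) $-(-r+s)+-(-r+-s)=r$; (R4) $r;(s;t)=(r;s);t$; (R5) $r;1'=r$; (R6) $(r^{\smile})^{\smile}=r$; (R8) $(r+s);t=r;t+s;t$; (R8$'$) $r;(s+t)=r;s+r;t$; (R10) $r^{\smile};-(r;s)+-s=-s$, i.e. $\bigl((r^{\smile});(-(r;s))\bigr)+(-s)=-s$. A set of axioms is independent if none of the axioms in it can be derived from the remaining ones; for each axiom this is witnessed by a model in which that axiom fails and all the remaining axioms are valid. *)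

(* Defs.v *)
From Stdlib Require Import List.
Import ListNotations.

(** [ident] is the element written 1'. It also makes the carrier non-empty. *)
Record algebra : Type := Algebra {
  carrier :> Type;
  plus : carrier -> carrier -> carrier;
  compl : carrier -> carrier;
  comp : carrier -> carrier -> carrier;
  conv : carrier -> carrier;
  ident : carrier
}.

Inductive term : Type :=
| Var (n : nat)
| Plus (u v : term)
| Compl (u : term)
| Comp (u v : term)
| Conv (u : term)
| Ident.

Inductive equation : Type := Eqn (lhs rhs : term).

Declare Scope term_scope.
Delimit Scope term_scope with term.
Bind Scope term_scope with term.
Notation "u + v" := (Plus u v) : term_scope.
Notation "- u" := (Compl u) : term_scope.
Notation "u ;; v" := (Comp u v) (at level 40, left associativity) : term_scope.
Notation "u ^~" := (Conv u) (at level 29, left associativity) : term_scope.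
Notation "u == v" := (Eqn u v) (at level 70, no associativity) : term_scope.

Fixpoint eval (A : algebra) (e : nat -> A) (u : term) : A :=
  match u with
  | Var n => e n
  | Plus u v => plus A (eval A e u) (eval A e v)
  | Compl u => compl A (eval A e u)
  | Comp u v => comp A (eval A e u) (eval A e v)
  | Conv u => conv A (eval A e u)
  | Ident => ident A
  end.

Definition valid (A : algebra) (phi : equation) : Prop :=
  match phi with
  | Eqn u v => forall e : nat -> A, eval A e u = eval A e v
  end.

Definition fails (A : algebra) (phi : equation) : Prop := ~ valid A phi.

Fixpoint subst (f : nat -> term) (u : term) : term :=
  match u with
  | Var n => f n
  | Plus u v => Plus (subst f u) (subst f v)
  | Compl u => Compl (subst f u)
  | Comp u v => Comp (subst f u) (subst f v)
  | Conv u => Conv (subst f u)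
  | Ident => Ident
  end.

(** Equational logic (Birkhoff's rules): derivability from the equations
    satisfying [Ax], whose variables are implicitly universally quantified. *)
Inductive derivable (Ax : equation -> Prop) : equation -> Prop :=
| d_axiom u v f : Ax (Eqn u v) -> derivable Ax (Eqn (subst f u) (subst f v))
| d_refl u : derivable Ax (Eqn u u)
| d_sym u v : derivable Ax (Eqn u v) -> derivable Ax (Eqn v u)
| d_trans u v w :
    derivable Ax (Eqn u v) -> derivable Ax (Eqn v w) -> derivable Ax (Eqn u w)
| d_plus u u' v v' :
    derivable Ax (Eqn u u') -> derivable Ax (Eqn v v') ->
    derivable Ax (Eqn (Plus u v) (Plus u' v'))
| d_compl u u' :
    derivable Ax (Eqn u u') -> derivable Ax (Eqn (Compl u) (Compl u'))
| d_comp u u' v v' :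
    derivable Ax (Eqn u u') -> derivable Ax (Eqn v v') ->
    derivable Ax (Eqn (Comp u v) (Comp u' v'))
| d_conv u u' :
    derivable Ax (Eqn u u') -> derivable Ax (Eqn (Conv u) (Conv u')).

Section Equations.
Local Open Scope term_scope.
Local Notation r := (Var 0).
Local Notation s := (Var 1).
Local Notation t := (Var 2).

Definition R1 : equation := r + s == s + r.
Definition R2 : equation := r + (s + t) == (r + s) + t.
Definition R3 : equation := - (- r + s) + - (- r + - s) == r.
Definition R4 : equation := r ;; (s ;; t) == (r ;; s) ;; t.
Definition R5 : equation := r ;; Ident == r.
Definition R6 : equation := (r^~)^~ == r.
Definition R8 : equation := (r + s) ;; t == r ;; t + s ;; t.
Definition R8' : equation := r ;; (s + t) == r ;; s + r ;; t.
Definition R10 : equation := r^~ ;; - (r ;; s) + - s == - s.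
End Equations.

Definition S_axioms (phi : equation) : Prop :=
  In phi [R1; R2; R3; R4; R5; R6; R8; R8'; R10].

Definition others (Ax : equation -> Prop) (phi : equation) : equation -> Prop :=
  fun psi => Ax psi /\ psi <> phi.

Definition independent (Ax : equation -> Prop) : Prop :=
  forall phi : equation, Ax phi -> ~ derivable (others Ax phi) phi.

(* Main.v *)
From Stdlib Require Import Bool.
Require Import Defs.

(** Each axiom is separated from the others by a finite algebra.  All of these
    algebras except those for (R1), (R2) and (R3) are finite Boolean algebras with
    additional operators; independence then follows from the soundness of
    equational logic. *)

Lemma eval_subst (A : algebra) (e : nat -> A) (f : nat -> term) (u : term) :
  eval A e (subst f u) = eval A (fun n => eval A e (f n)) u.
Proof. induction u; cbn; congruence. Qed.

Lemma derivable_sound (A : algebra) (Ax : equation -> Prop) (phi : equation) :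
  (forall psi, Ax psi -> valid A psi) -> derivable Ax phi -> valid A phi.
Proof.
  intros HA D.
  induction D as [u v f H| | | | | | |]; cbn in *; intros e; try congruence.
  rewrite !eval_subst. apply (HA _ H).
Qed.

Definition separates (A : algebra) (Ax : equation -> Prop) (phi : equation) : Prop :=
  fails A phi /\ forall psi, others Ax phi psi -> valid A psi.

Lemma separated_independent (Ax : equation -> Prop) :
  (forall phi, Ax phi -> exists A, separates A Ax phi) -> independent Ax.
Proof.
  intros H phi Hphi D. destruct (H phi Hphi) as [A [Hf HA]].
  exact (Hf (derivable_sound A _ phi HA D)).
Qed.

(** As [plus] is the left projection, (R10) reduces to r;(r;s) = s, which exclusive or satisfies. *)
Definition R1_model : algebra :=
  Algebra bool (fun r _ => r) (fun r => r) xorb (fun r => r) false.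

(* The signs -1, 0, 1, encoded as [Lt], [Eq], [Gt]: the sum is the sign of the
   integer sum, so that (1 + 1) + -1 = 0 while 1 + (1 + -1) = 1. *)
Definition sign_plus (r s : comparison) : comparison :=
  match r, s with
  | Eq, x | x, Eq => x
  | Lt, Lt => Lt
  | Gt, Gt => Gt
  | _, _ => Eq
  end.

Definition sign_mult (r s : comparison) : comparison :=
  match r with
  | Lt => CompOpp s
  | Eq => Eq
  | Gt => s
  end.

Definition R2_model : algebra :=
  Algebra comparison sign_plus CompOpp sign_mult (fun r => r) Gt.

(** With complement the identity, (R10) becomes absorption, while (R3) would force r + s = r. *)
Definition R3_model : algebra :=
  Algebra bool orb (fun r => r) andb (fun r => r) true.

Definition bool3 : Type := bool * bool * bool.

Definition orb3 (r s : bool3) : bool3 :=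
  let '(r0, r1, r2) := r in
  let '(s0, s1, s2) := s in (r0 || s0, r1 || s1, r2 || s2).

Definition negb3 (r : bool3) : bool3 :=
  let '(r0, r1, r2) := r in (negb r0, negb r1, negb r2).

(* Atoms 1', a, b with a;a = b;b = 1' and a;b = b;a = 0, so that
   (a;a);b = b while a;(a;b) = 0. *)
Definition R4_comp (r s : bool3) : bool3 :=
  let '(r0, r1, r2) := r in
  let '(s0, s1, s2) := s in
  (r0 && s0 || r1 && s1 || r2 && s2, r0 && s1 || r1 && s0, r0 && s2 || r2 && s0).

Definition R4_model : algebra :=
  Algebra bool3 orb3 negb3 R4_comp (fun r => r) (true, false, false).

Definition R5_model : algebra :=
  Algebra bool orb negb (fun _ _ => false) (fun r => r) true.

Definition R6_model : algebra :=
  Algebra bool orb negb andb (fun _ => false) true.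

(* Subsets of Z/3.  The map s |-> r;s is the image under a relation L_r, where
   L_{k} is the rotation i |-> k + i, L_r for r the complement of {k} is the
   complement of the reflection i |-> k - i, and L_r is the empty, respectively
   full, relation when r is.  These relations are closed under composition
   and converse, and L_r maps {0} to r, which gives (R4)-(R6), (R8') and (R10).
   Using reflections instead of rotations for the complements breaks (R8). *)
Definition R8_comp (r s : bool3) : bool3 :=
  let '(s0, s1, s2) := s in
  match r with
  | (false, false, false) => (false, false, false)
  | (true, false, false) => (s0, s1, s2)
  | (false, true, false) => (s2, s0, s1)
  | (false, false, true) => (s1, s2, s0)
  | (false, true, true) => (s1 || s2, s0 || s1, s0 || s2)
  | (true, false, true) => (s0 || s2, s1 || s2, s0 || s1)
  | (true, true, false) => (s0 || s1, s0 || s2, s1 || s2)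
  | (true, true, true) => let x := s0 || s1 || s2 in (x, x, x)
  end.

Definition R8_conv (r : bool3) : bool3 :=
  match r with
  | (false, true, false) => (false, false, true)
  | (false, false, true) => (false, true, false)
  | _ => r
  end.

Definition R8_model : algebra :=
  Algebra bool3 orb3 negb3 R8_comp R8_conv (true, false, false).

Definition orb2 (r s : bool * bool) : bool * bool :=
  (fst r || fst s, snd r || snd s).

Definition negb2 (r : bool * bool) : bool * bool := (negb (fst r), negb (snd r)).

(* Right composition with one atom is the identity, with the other the
   automorphism exchanging the atoms, but with their join it is constant 0. *)
Definition R8'_comp (r s : bool * bool) : bool * bool :=
  match s with
  | (true, false) => r
  | (false, true) => (snd r, fst r)
  | _ => (false, false)
  end.

Definition R8'_model : algebra :=
  Algebra (bool * bool) orb2 negb2 R8'_comp (fun r => r) (true, false).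

(** Besides (R10) only (R6) mentions converse, so any involution is allowed. *)
Definition R10_model : algebra := Algebra bool orb negb andb negb true.

Ltac refute x y z :=
  let H := fresh in
  intro H;
  specialize (H (fun n => match n with 0 => x | 1 => y | _ => z end));
  discriminate H.

Ltac split_elements :=
  repeat match goal with
  | r : (_ * _)%type |- _ => destruct r
  | b : bool |- _ => destruct b
  | c : comparison |- _ => destruct c
  end.

Ltac check_others :=
  let Hin := fresh in
  let Hne := fresh in
  intros psi [Hin Hne]; cbn in Hin;
  repeat destruct Hin as [<-|Hin];
  [ .. | destruct Hin ];
  try (exfalso; apply Hne; reflexivity);
  intros e; cbn;
  (* Only the values of [e] at 0, 1, 2 matter, so validity becomes a finite case check. *)
  try generalize (e 2); try generalize (e 1); generalize (e 0);
  clear; cbn; unfold bool3; intros; split_elements; reflexivity.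

Lemma R1_separated : separates R1_model S_axioms R1.
Proof. split; [refute true false false | check_others]. Qed.

Lemma R2_separated : separates R2_model S_axioms R2.
Proof. split; [refute Gt Gt Lt | check_others]. Qed.

Lemma R3_separated : separates R3_model S_axioms R3.
Proof. split; [refute false true false | check_others]. Qed.

Lemma R4_separated : separates R4_model S_axioms R4.
Proof.
  split; [| check_others].
  refute (false, true, false) (false, true, false) (false, false, true).
Qed.

Lemma R5_separated : separates R5_model S_axioms R5.
Proof. split; [refute true true true | check_others]. Qed.

Lemma R6_separated : separates R6_model S_axioms R6.
Proof. split; [refute true true true | check_others]. Qed.

Lemma R8_separated : separates R8_model S_axioms R8.
Proof.
  split; [| check_others].
  refute (true, false, false) (false, true, false) (false, true, false).
Qed.

Lemma R8'_separated : separates R8'_model S_axioms R8'.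
Proof.
  split; [| check_others].
  refute (true, false) (true, false) (false, true).
Qed.

Lemma R10_separated : separates R10_model S_axioms R10.
Proof. split; [refute false true true | check_others]. Qed.

Lemma S_axioms_separated (phi : equation) :
  S_axioms phi -> exists A, separates A S_axioms phi.
Proof.
  intros H; cbn in H.
  destruct H as [<-|[<-|[<-|[<-|[<-|[<-|[<-|[<-|[<-|[]]]]]]]]]]; eexists.
  - exact R1_separated.
  - exact R2_separated.
  - exact R3_separated.
  - exact R4_separated.
  - exact R5_separated.
  - exact R6_separated.
  - exact R8_separated.
  - exact R8'_separated.
  - exact R10_separated.
Qed.

Theorem theorem5 :
  independent S_axioms /\
  (forall phi : equation, S_axioms phi ->
     exists A : algebra,
       fails A phi /\
       (forall psi : equation, others S_axioms phi psi -> valid A psi)).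
Proof.
  split; [apply separated_independent |]; exact S_axioms_separated.
Qed.
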